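(* Consider the following distribution $\mathcal{P}_{\mathrm{finite}\text{-}\mathrm{hard}}$ with $m=2$ resources: the replenishment is deterministic, $\bm b_t=(1,1)$ for every $t$, and the order $(r_t,\bm a_t)$ equals $(R_i,\bm A_i)$ with probability $\mu_i$, where $\bm A_1=(2,2),R_1=5,\mu_1=\tfrac14$; $\bm A_2=(2,0),R_2=3,\mu_2=\tfrac18$; $\bm A_3=(0,2),R_3=3,\mu_3=\tfrac18$; $\bm A_4=(2,0),R_4=4,\mu_4=\tfrac18$; $\bm A_5=(0,2),R_5=4,\mu_5=\tfrac18$; $\bm A_6=(0,0),R_6=0,\mu_6=\tfrac14$, orders being i.i.d. across periods. There exist universal constants $T_{\mathrm{finite}\text{-}\mathrm{hard}}>0$ and $c>0$ such that for every $T>T_{\mathrm{finite}\text{-}\mathrm{hard}}$ and every feasible online policy $\bm\pi$ (even one that knows $\mathcal{P}_{\mathrm{finite}\text{-}\mathrm{hard}}$), $$\mathrm{Regret}_{\mathcal{P}_{\mathrm{finite}\text{-}\mathrm{hard}}}(\bm\pi)\ge c\sqrt T.$$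
   Context: Online linear programming with replenishment. There are $m$ resources and a horizon $T$. Tuples $(r_t,\bm{a}_t,\bm{b}_t)\in\mathbb{R}\times\mathbb{R}^m\times\mathbb{R}^m_{\geq 0}$, $t=1,\dots,T$, are drawn i.i.d. from a distribution $\mathcal{P}$. Inventory starts at $0$. In period $t$ each resource $j$ is first replenished by $b_{jt}$; then the order $(r_t,\bm{a}_t)$ is revealed and the decision maker chooses $x_t\in\{0,1\}$ (possibly at random) based only on $(r_k,\bm{a}_k,\bm{b}_k,x_k)_{k<t}$ and $(r_t,\bm{a}_t,\bm{b}_t)$. A policy is feasible if for every realization $\sum_{k\le t}a_{jk}x_k\le\sum_{k\le t}b_{jk}$ for all $j\in[m]$, $t\in[T]$. The hindsight optimum $R^*$ is the maximum of $\sum_t r_tx_t$ over $\bm x\in\{0,1\}^T$ subject to these prefix constraints, and $\mathrm{Regret}_{\mathcal{P}}(\bm{\pi})=\mathbb{E}[R^*-\sum_t r_tx_t]$. *)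

(* Defs.v *)
From HB Require Import structures.
From mathcomp Require Import all_boot all_order all_algebra.
From mathcomp Require Import reals Rstruct.
From Stdlib Require Rdefinitions.
Notation R := Rdefinitions.R.
Set Implicit Arguments.
Unset Strict Implicit.
Unset Printing Implicit Defensive.
Import Order.TTheory GRing.Theory Num.Theory.
Local Open Scope ring_scope.

(* Order types i = 0..5 stand for the paper's types 1..6. *)
Definition ordtype := 'I_6.

Definition rew (i : ordtype) : nat := nth 0%N [:: 5; 3; 3; 4; 4; 0]%N i.

Definition cons (i : ordtype) (j : 'I_2) : nat :=
  if j == 0 :> nat then nth 0%N [:: 2; 2; 0; 2; 0; 0]%N i
  else nth 0%N [:: 2; 0; 2; 0; 2; 0]%N i.

Definition mu (i : ordtype) : R :=
  nth 0 [:: 1/4; 1/8; 1/8; 1/8; 1/8; 1/4] i.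

(* Feasibility of a decision vector x for a realization w with deterministic
   replenishment b_t = (1,1): for every prefix t+1 <= T and resource j,
   sum_{k<=t} a_{jk} x_k <= sum_{k<=t} b_{jk} = t+1. *)
Definition feasible (T : nat) (w : T.-tuple ordtype) (x : T.-tuple bool) : bool :=
  [forall t : 'I_T, forall j : 'I_2,
     ((\sum_(k < t.+1) cons (nth ord0 w k) j * nth false x k)%N <= t.+1)%N].

Definition reward (T : nat) (w : T.-tuple ordtype) (x : T.-tuple bool) : R :=
  (\sum_(k < T) (rew (nth ord0 w k) * nth false x k)%N%:R).

Definition probw (T : nat) (w : T.-tuple ordtype) : R :=
  \prod_(k < T) mu (nth ord0 w k).

(* Hindsight optimum R^* (the zero vector is always feasible and rewards are
   nonnegative, so taking the max with base 0 is harmless). *)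
Definition hindsight (T : nat) (w : T.-tuple ordtype) : R :=
  \big[Num.max/0]_(x : T.-tuple bool | feasible w x) reward w x.

(* A (possibly randomized) online policy: given the history
   (type_k, x_k)_{k<t} and the current order type, it returns the probability
   of accepting (x_t = 1).  The order (r_t, a_t) determines the type uniquely
   and b_t is deterministic, so this is exactly the information available. *)
Definition policy := seq (ordtype * bool) -> ordtype -> R.

Definition history (T t : nat) (w : T.-tuple ordtype) (x : T.-tuple bool)
  : seq (ordtype * bool) := zip (take t w) (take t x).

Definition accept_prob (T : nat) (pi : policy) (w : T.-tuple ordtype)
  (x : T.-tuple bool) (t : nat) : R :=
  pi (history t w x) (nth ord0 w t).

Definition probwx (T : nat) (pi : policy) (w : T.-tuple ordtype)
  (x : T.-tuple bool) : R :=
  probw w * \prod_(t < T)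
     (if nth false x t then accept_prob pi w x t else 1 - accept_prob pi w x t).

Definition valid_policy (T : nat) (pi : policy) : Prop :=
  (forall h i, 0 <= pi h i <= 1) /\
  (forall (w : T.-tuple ordtype) (x : T.-tuple bool),
     probwx pi w x > 0 -> feasible w x).

Definition expected_policy_reward (T : nat) (pi : policy) : R :=
  \sum_(w : T.-tuple ordtype) \sum_(x : T.-tuple bool) probwx pi w x * reward w x.

Definition expected_hindsight (T : nat) : R :=
  \sum_(w : T.-tuple ordtype) probw w * hindsight w.

Definition regret (T : nat) (pi : policy) : R :=
  expected_hindsight T - expected_policy_reward T pi.

(* Main.v *)
Require Import Defs.
From HB Require Import structures.
From mathcomp Require Import all_boot all_order all_algebra.
From mathcomp Require Import reals Rstruct.
From mathcomp Require Import ring lra.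
From mathcomp Require Import sequences exp.
Set Implicit Arguments.
Unset Strict Implicit.
Unset Printing Implicit Defensive.
Import Order.TTheory GRing.Theory Num.Theory.
Local Open Scope ring_scope.

(* Accepting every order makes the two inventories independent simple random
   walks, so shortages are of order sqrt T.  If resource 1 is short at T/2, the
   policy has already refused ~ sqrt T orders using it, each time choosing
   between type 1, the right choice if resource 2 ends up equally short, and
   types 2 and 4, the right choice if resource 2 stays safe.  Two tilted laws
   with drift ~ 1/sqrt T coincide up to T/2 and realize these two futures, so
   under one of them the policy is wrong ~ sqrt T times with positive
   probability (Le Cam's two-point argument).  The chi-square divergence of each
   tilted law from the original one is bounded uniformly in T, so this event
   also has probability bounded below under the original law. *)

(** * Expectation over histories *)

Section Expectation.
Context {I : finType}.
Implicit Types (pi : seq (I * bool) -> I -> R) (q : nat -> I -> R)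
  (h : seq (I * bool)) (f : seq (I * bool) -> R) (g : I -> R) (w : seq I).

(** [N] counts the periods still to come, while [size h] is the current period, so that the law [q]
    of the orders may vary in time. *)
Fixpoint expect pi q N f h : R :=
  if N is N'.+1 then
    \sum_i q (size h) i *
      (pi h i * expect pi q N' f (rcons h (i, true)) +
       (1 - pi h i) * expect pi q N' f (rcons h (i, false)))
  else f h.

Section Props.
Variables (pi : seq (I * bool) -> I -> R) (q : nat -> I -> R).
Hypothesis pi01 : forall h i, 0 <= pi h i <= 1.
Hypothesis q_ge0 : forall k i, 0 <= q k i.
Hypothesis q_sum1 : forall k, \sum_i q k i = 1.

Lemma mix_le h i (u v u' v' : R) : u <= u' -> v <= v' ->
  pi h i * u + (1 - pi h i) * v <= pi h i * u' + (1 - pi h i) * v'.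
Proof. by move=> uu vv; have /andP[p0 p1] := pi01 h i; nra. Qed.

Lemma expect_le N f f' h : (forall h', f h' <= f' h') ->
  expect pi q N f h <= expect pi q N f' h.
Proof.
move=> ff'; elim: N h => [|N IH] h /=; first exact: ff'.
by apply: ler_sum => i _; apply: ler_wpM2l => //; apply: mix_le; apply: IH.
Qed.

Lemma expect_ge0 N f h : (forall h, 0 <= f h) -> 0 <= expect pi q N f h.
Proof.
move=> f0; elim: N h => [//|N IH] h /=.
apply: sumr_ge0 => i _; have /andP[p0 p1] := pi01 h i.
by rewrite mulr_ge0 ?addr_ge0 ?mulr_ge0 ?subr_ge0.
Qed.

Lemma expect_cst N (c : R) h : expect pi q N (fun=> c) h = c.
Proof.
elim: N h => [//|N IH] h /=.
under eq_bigr => i _ do rewrite !IH -mulrDl addrC subrK mul1r.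
by rewrite -mulr_suml q_sum1 mul1r.
Qed.

Lemma expectD N f f' h :
  expect pi q N (fun h => f h + f' h) h =
  expect pi q N f h + expect pi q N f' h.
Proof.
elim: N h => [//|N IH] h /=; rewrite -big_split /=.
by apply: eq_bigr => i _; rewrite !IH; ring.
Qed.

(** When [w] is drawn from [q], this is a martingale in [t], whatever the policy does. *)
Definition centered (i0 : I) (g : I -> R) (w : seq I) (t : nat) : R :=
  \sum_(k < t) (g (nth i0 w k) - \sum_i q k i * g i).

Definition exits (i0 : I) (g : I -> R) (lam : R) (w : seq I) : bool :=
  has (fun t => lam < `|centered i0 g w t|) (iota 0 (size w).+1).

Lemma centered_rcons i0 g w i t : (t <= size w)%N ->
  centered i0 g (rcons w i) t = centered i0 g w t.
Proof.
move=> tw; apply: eq_bigr => k _; congr (g _ - _).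
by rewrite nth_rcons (leq_trans (ltn_ord k) tw).
Qed.

Lemma centered_rcons_size i0 g w i :
  centered i0 g (rcons w i) (size w).+1 =
  centered i0 g w (size w) + (g i - \sum_i q (size w) i * g i).
Proof.
rewrite /centered big_ord_recr /= -/(centered i0 g (rcons w i) _).
by rewrite centered_rcons// nth_rcons ltnn eqxx.
Qed.

Lemma exits_rcons i0 g lam w i :
  exits i0 g lam (rcons w i) =
  exits i0 g lam w || (lam < `|centered i0 g (rcons w i) (size w).+1|).
Proof.
rewrite /exits size_rcons -[(size w).+2]addn1 iotaD has_cat add0n.
rewrite [has _ (iota _ 1)]/= orbF.
congr (_ || _); apply: eq_in_has => t; rewrite mem_iota add0n ltnS => /andP[_ tw].
by rewrite centered_rcons.
Qed.

Lemma exitsPn i0 g lam w :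
  ~~ exits i0 g lam w ->
  forall t, (t <= size w)%N -> `|centered i0 g w t| <= lam.
Proof.
move=> /hasPn H t tw; rewrite leNgt; apply: H.
by rewrite mem_iota add0n ltnS.
Qed.

(* Kolmogorov's maximal inequality: [(M_k^2 + (N - k)) / lam^2] is a
   supermartingale dominating the indicator of the exit. *)
Lemma expect_exits_from i0 g lam N h : 0 < lam -> (forall i, `|g i| <= 1) ->
  ~~ exits i0 g lam (unzip1 h) ->
  expect pi q N (fun h => (exits i0 g lam (unzip1 h))%:R) h <=
  (centered i0 g (unzip1 h) (size h) ^+ 2 + N%:R) / lam ^+ 2.
Proof.
move=> lam0 g1; have lam2 : 0 < lam ^+ 2 by rewrite exprn_gt0.
elim: N h => [|N IH] h hN.
  by rewrite /= (negbTE hN) divr_ge0 ?addr0 ?sqr_ge0 ?ltW.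
rewrite /=; set m := \sum_i q (size h) i * g i.
set M := centered i0 g (unzip1 h) (size h).
have step i b : expect pi q N (fun h => (exits i0 g lam (unzip1 h))%:R)
    (rcons h (i, b)) <= ((M + (g i - m)) ^+ 2 + N%:R) / lam ^+ 2.
  have E : centered i0 g (unzip1 (rcons h (i, b))) (size (rcons h (i, b))) =
      M + (g i - m).
    rewrite /unzip1 map_rcons size_rcons -(size_map fst h) centered_rcons_size.
    by rewrite size_map.
  have [bad|ok] := boolP (exits i0 g lam (unzip1 (rcons h (i, b)))); last first.
    by rewrite -E; apply: IH.
  (* At the first exit the claimed bound already exceeds 1, which dominates the expectation of any
     indicator. *)
  have : lam < `|M + (g i - m)|.
    move: bad; rewrite -E /unzip1 map_rcons exits_rcons (negbTE hN) /=.
    by rewrite size_map size_rcons.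
  move=> lamM; apply: (@le_trans _ _ 1).
    rewrite -[leRHS](expect_cst N 1 (rcons h (i, b))); apply: expect_le => h'.
    by case: exits.
  rewrite ler_pdivlMr// mul1r -(real_normK (num_real (M + (g i - m)))).
  have : lam ^+ 2 <= `|M + (g i - m)| ^+ 2 by rewrite ler_sqr ?nnegrE// ltW.
  by have := ler0n R N; lra.
have -> : (M ^+ 2 + N.+1%:R) / lam ^+ 2 = 
   (M ^+ 2 + (1 + N%:R)) / lam ^+ 2 by rewrite -natr1 [_ + 1]addrC.
apply: (@le_trans _ _ (\sum_i q (size h) i *
    (((M + (g i - m)) ^+ 2 + N%:R) / lam ^+ 2))).
  apply: ler_sum => i _; apply: ler_wpM2l => //.
  apply: le_trans (mix_le h i (step i true) (step i false)) _.
  by rewrite -mulrDl addrC subrK mul1r.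
(* It remains to average [(M + (g i - m)) ^+ 2]: the cross term vanishes, and the variance of [g] is
   at most 1, which is the unit that [N.+1] has over [N]. *)
under eq_bigr => i _ do rewrite mulrA.
rewrite -mulr_suml ler_pM2r ?invr_gt0//.
rewrite (eq_bigr (fun i => (M ^+ 2 + N%:R - 2 * M * m + m ^+ 2) * q (size h) i +
  (2 * M - 2 * m) * (q (size h) i * g i) + q (size h) i * g i ^+ 2));
  last by move=> i _; ring.
rewrite !big_split /= -!mulr_sumr q_sum1 -/m.
have : \sum_i q (size h) i * g i ^+ 2 <= 1.
  rewrite -[leRHS](q_sum1 (size h)); apply: ler_sum => i _.
  rewrite -[leRHS]mulr1; apply: ler_wpM2l => //.
  by rewrite -real_normK ?num_real// expr_le1.
have := sqr_ge0 m; nra.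
Qed.

Lemma expect_exits i0 g lam N : 0 < lam -> (forall i, `|g i| <= 1) ->
  expect pi q N (fun h => (exits i0 g lam (unzip1 h))%:R) [::] <=
  N%:R / lam ^+ 2.
Proof.
move=> lam0 g1; apply: le_trans (@expect_exits_from i0 g lam N [::] lam0 g1 _) _.
  by rewrite /exits /= /centered big_ord0 normr0 orbF -leNgt ltW.
by rewrite /= /centered big_ord0 expr0n /= add0r.
Qed.

Lemma expect_determined t N f h : (forall h, f h = f (take t h)) ->
  (t <= size h)%N -> expect pi q N f h = f h.
Proof.
move=> ft; elim: N h => [//|N IH] h th /=.
rewrite -[RHS]mul1r -[X in _ = X * _](q_sum1 (size h)) mulr_suml.
apply: eq_bigr => i _.
have E b : expect pi q N f (rcons h (i, b)) = f h.
  rewrite IH ?size_rcons ?leqW// ft -cats1 take_cat.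
  move: th; rewrite leq_eqVlt => /orP[/eqP->|->]; last by rewrite -ft.
  by rewrite ltnn subnn take0 cats0.
by rewrite !E -mulrDl addrC subrK mul1r.
Qed.
End Props.

(** Once [t] periods have passed, [f] is settled and the laws of later periods integrate to 1;
    before that the two laws coincide. *)
Lemma expect_local pi q q' t N f h : 
  (forall k, \sum_i q k i = 1) -> (forall k, \sum_i q' k i = 1) ->
  (forall k, (k < t)%N -> q k =1 q' k) -> (forall h, f h = f (take t h)) ->
  expect pi q N f h = expect pi q' N f h.
Proof.
move=> q1 q'1 qq' ft; elim: N h => [//|N IH] h.
have [ht|th] := ltnP (size h) t.
  by rewrite /=; apply: eq_bigr => i _; rewrite qq'// !IH.
by rewrite !(expect_determined _ _ _ ft).
Qed.

(* Where the likelihood ratio [L = q/p] is at most [K] we have [q <= K p], and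
   elsewhere [q <= L q / K]. *)
Lemma expect_change_measure pi p q (C K : R) N f h :
  (forall h i, 0 <= pi h i <= 1) ->
  (forall k i, 0 < p k i) -> (forall k i, 0 <= q k i) ->
  (forall k, \sum_i q k i ^+ 2 / p k i <= C) -> (forall h, 0 <= f h <= 1) ->
  0 < K ->
  expect pi q N f h <= K * expect pi p N f h + C ^+ N / K.
Proof.
move=> pi01 p0 q0 qC f01; elim: N h K => [|N IH] h K K0.
  rewrite /= expr0; have /andP[f0 f1] := f01 h.
  have KV : 0 < K^-1 by rewrite invr_gt0.
  have KK : K * K^-1 = 1 by rewrite mulfV ?gt_eqF.
  (* With no period left the claim is [f <= K * f + 1 / K] for [f] in [0, 1]: the first term
     suffices if [K >= 1], the second otherwise. *)
  have [K1|K1] := leP 1 K; first by nra.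
  by have : 1 <= K^-1; [rewrite -invr1 lef_pV2 ?posrE// ltW|nra].
have C0 : 0 <= C.
  apply: le_trans (qC 0%N); apply: sumr_ge0 => i _.
  by rewrite divr_ge0 ?sqr_ge0 ?ltW.
rewrite /= mulr_sumr; set n := size h.
apply: (@le_trans _ _ (\sum_i (K * (p n i * (pi h i * 
    expect pi p N f (rcons h (i, true)) + 
    (1 - pi h i) * expect pi p N f (rcons h (i, false)))) +
    q n i ^+ 2 / p n i * (C ^+ N / K)))); last first.
  rewrite big_split /= lerD2l -mulr_suml exprS -mulrA.
  by apply: ler_wpM2r => //; rewrite divr_ge0 ?exprn_ge0 ?(ltW K0).
apply: ler_sum => i _; set Ep := pi h i * expect pi p N f _ + _.
have Ep0 : 0 <= Ep.
  have /andP[? ?] := pi01 h i.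
  have E0 b : 0 <= expect pi p N f (rcons h (i, b)).
    apply: expect_ge0 => // [k j|h']; first exact: ltW.
    by have /andP[] := f01 h'.
  by rewrite /Ep addr_ge0 ?mulr_ge0 ?subr_ge0.
have [->|qn0] := eqVneq (q n i) 0.
  by rewrite mul0r expr0n /= !mul0r addr0 !mulr_ge0 ?(ltW K0) ?(ltW (p0 _ _)).
have qn : 0 < q n i by rewrite lt_def qn0 q0.
(* The induction hypothesis is applied with the threshold [K] divided by the likelihood ratio of the
   current order, hence the quantification over [K] in the induction. *)
have K'0 : 0 < K * p n i / q n i by rewrite divr_gt0 ?mulr_gt0.
apply: (@le_trans _ _ (q n i * (K * p n i / q n i * Ep + 
   C ^+ N / (K * p n i / q n i)))).
  apply: ler_wpM2l => //.
  apply: le_trans (mix_le pi01 h i (IH _ _ K'0) (IH _ _ K'0)) _.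
  by rewrite /Ep le_eqVlt; apply/orP; left; apply/eqP; ring.
have := p0 n i; move=> pn; rewrite le_eqVlt; apply/orP; left; apply/eqP.
by field; rewrite !gt_eqF.
Qed.
End Expectation.

(** * Regret as an expectation over histories *)

Lemma big_tuple0 (I : finType) (F : 0.-tuple I -> R) :
  \sum_(w : 0.-tuple I) F w = F [tuple].
Proof. by rewrite (big_pred1 [tuple]) // => w; rewrite [w]tuple0; apply/esym/eqP. Qed.

Lemma big_tuple_cons (I : finType) N (F : N.+1.-tuple I -> R) :
  \sum_(w : N.+1.-tuple I) F w =
  \sum_(i : I) \sum_(w : N.-tuple I) F [tuple of i :: w].
Proof.
rewrite pair_big /=.
rewrite (reindex (fun p : I * N.-tuple I => [tuple of p.1 :: p.2])) //=.
exists (fun w : N.+1.-tuple I => (thead w, [tuple of behead w])) => [[i w] _|w _] /=.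
  by rewrite theadE; congr (_, _); apply: val_inj.
by rewrite [RHS]tuple_eta; apply: val_inj.
Qed.

(** The policy's factor in [probwx], with a past [h] put in front to allow induction on [T]. *)
Definition policy_kernel (T : nat) (pi : policy) h (w : T.-tuple ordtype)
    (x : T.-tuple bool) : R :=
  \prod_(t < T)
    (let p := pi (h ++ history t w x) (nth ord0 w t) in
     if nth false x t then p else 1 - p).

Lemma policy_kernel_cons T pi h i b (w : T.-tuple ordtype) (x : T.-tuple bool) :
  policy_kernel pi h [tuple of i :: w] [tuple of b :: x] =
  (if b then pi h i else 1 - pi h i) * policy_kernel pi (rcons h (i, b)) w x.
Proof.
rewrite /policy_kernel big_ord_recl /history /= cats0; congr (_ * _).
by apply: eq_bigr => t _; rewrite /= cat_rcons.
Qed.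

Lemma probwxE T pi (w : T.-tuple ordtype) x :
  probwx pi w x = probw w * policy_kernel pi [::] w x.
Proof. by []. Qed.

Lemma policy_kernel_sum1 T pi h (w : T.-tuple ordtype) :
  \sum_(x : T.-tuple bool) policy_kernel pi h w x = 1.
Proof.
elim: T h w => [|T IH] h w.
  by rewrite big_tuple0 /policy_kernel big_ord0.
rewrite big_tuple_cons (tuple_eta w) big_bool /=.
under eq_bigr => x _ do rewrite policy_kernel_cons.
under [X in _ + X]eq_bigr => x _ do rewrite policy_kernel_cons.
by rewrite -!mulr_sumr !IH /= !mulr1 addrC subrK.
Qed.

Lemma expect_tuple (pi : policy) q N f h :
  \sum_(w : N.-tuple ordtype) \sum_(x : N.-tuple bool)
    (\prod_(k < N) q (size h + k)%N (nth ord0 w k)) *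
    policy_kernel pi h w x * f (h ++ zip w x) = expect pi q N f h.
Proof.
elim: N h => [|N IH] h.
  by rewrite !big_tuple0 /policy_kernel !big_ord0 /= cats0 !mul1r.
rewrite big_tuple_cons /=; apply: eq_bigr => i _.
rewrite -!IH mulrDr !mulr_sumr -big_split /=; apply: eq_bigr => w _.
rewrite big_tuple_cons big_bool /= !mulr_sumr.
have E b : \sum_(x : N.-tuple bool)
     \prod_(k < N.+1) q (size h + k)%N (nth ord0 (i :: w) k) *
      policy_kernel pi h [tuple of i :: w] [tuple of b :: x] *
      f (h ++ (i, b) :: zip w x) =
   q (size h) i * ((if b then pi h i else 1 - pi h i) * 
   \sum_(x : N.-tuple bool)
       (\prod_(k < N) q (size (rcons h (i, b)) + k)%N (nth ord0 w k)) *
       policy_kernel pi (rcons h (i, b)) w x * f (rcons h (i, b) ++ zip w x)).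
  rewrite !mulr_sumr; apply: eq_bigr => x _.
  rewrite policy_kernel_cons big_ord_recl addn0 /= cat_rcons size_rcons.
  under eq_bigr => k _ do rewrite /= /bump /= add1n addnS -addSn.
  by ring.
by rewrite !E /= !mulr_sumr.
Qed.

Lemma mu_gt0 i : 0 < mu i.
Proof. by case: i => [[|[|[|[|[|[|]]]]]] ?]; rewrite /mu //=; lra. Qed.

Lemma regretE T pi : regret T pi =
  \sum_(w : T.-tuple ordtype) \sum_(x : T.-tuple bool)
    probwx pi w x * (hindsight w - reward w x).
Proof.
rewrite /regret /expected_hindsight /expected_policy_reward -sumrB.
apply: eq_bigr => w _.
under [RHS]eq_bigr => x _ do rewrite mulrBr.
rewrite sumrB; congr (_ - _).
under [RHS]eq_bigr => x _ do rewrite probwxE mulrAC.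
by rewrite -mulr_sumr policy_kernel_sum1 mulr1.
Qed.

Lemma probwx_ge0 T pi (w : T.-tuple ordtype) x :
  (forall h i, 0 <= pi h i <= 1) -> 0 <= probwx pi w x.
Proof.
move=> pi01; apply: mulr_ge0; first by apply: prodr_ge0 => k _; exact/ltW/mu_gt0.
apply: prodr_ge0 => k _; have /andP[p0 p1] := pi01 (history k w x) (nth ord0 w k).
by rewrite /accept_prob; case: ifP => _; rewrite ?subr_ge0.
Qed.

(** A pathwise bound on feasible decisions is enough, since a valid policy gives probability 0 to
    all others. *)
Lemma regret_ge T pi (f : seq (ordtype * bool) -> R) (c : R) :
  valid_policy T pi ->
  (forall (w : T.-tuple ordtype) x, feasible w x ->
    c * f (zip w x) <= hindsight w - reward w x) ->
  c * expect pi (fun=> mu) T f [::] <= regret T pi.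
Proof.
move=> [pi01 pif] cf; rewrite regretE -expect_tuple mulr_sumr.
apply: ler_sum => w _; rewrite mulr_sumr; apply: ler_sum => x _.
rewrite /= -[_ * policy_kernel _ _ _ _]/(probwx pi w x) mulrCA.
have := probwx_ge0 w x pi01; rewrite le_eqVlt => /orP[/eqP <-|p0].
  by rewrite !mul0r.
by rewrite ler_pM2l//; apply: cf; apply: pif.
Qed.

(** * Pathwise accounting *)

Lemma sum_range (f : nat -> R) (m n : nat) : (m <= n)%N ->
  \sum_(m <= k < n) f k = \sum_(k < n) f k - \sum_(k < m) f k.
Proof.
move=> mn; rewrite -!(big_mkord xpredT f) (big_cat_nat (leq0n m) mn) /=.
by rewrite addrC addrK.
Qed.

Lemma ler_sum_ord_prefix (f : nat -> R) (m n : nat) : (m <= n)%N ->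
  (forall k, 0 <= f k) -> \sum_(k < m) f k <= \sum_(k < n) f k.
Proof.
by move=> mn f0; rewrite -subr_ge0 -sum_range// sumr_ge0.
Qed.

Lemma sum_if_lt (t n : nat) (u v : R) :
  \sum_(k < t) (if (k < n)%N then u else v) =
  (minn t n)%:R * u + (t - n)%:R * v.
Proof.
elim: t => [|t IH]; first by rewrite big_ord0 min0n sub0n !mul0r addr0.
rewrite big_ord_recr /= IH; have [tn|nt] := ltnP t n.
  have /eqP -> : (t - n == 0)%N by rewrite subn_eq0 ltnW.
  have /eqP -> : (t.+1 - n == 0)%N by rewrite subn_eq0.
  by rewrite (minn_idPl tn) -natr1; ring.
by rewrite subSn// -natr1; rewrite (minn_idPr (leqW nt)); ring.
Qed.

(** The least valuable order using resource 1 alone, hence the one to refuse when only resource 1 is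
    short. *)
Definition type2 : ordtype := @Ordinal 6 1 isT.

(** Net change of stock [j] when the order is accepted. It is 1 or -1, and under [mu] the two
    coordinates are centered and uncorrelated. *)
Definition xi (j : 'I_2) (i : ordtype) : R := 1 - (cons i j)%:R.

Section Path.
Variables (T : nat) (w : T.-tuple ordtype).

Definition walk (j : 'I_2) (t : nat) : R := \sum_(k < t) xi j (nth ord0 w k).
Definition arrivals (i : ordtype) (t : nat) : R :=
  \sum_(k < t) (nth ord0 w k == i)%:R.
Definition total : R := \sum_(k < T) (rew (nth ord0 w k))%:R.

(** A nearly optimal hindsight decision: refusing everything before [d] builds a buffer against
    fluctuations, and refusing type [i] from [d] to [tau] compensates the drift. *)
Definition plan (d tau : nat) (i : ordtype) : T.-tuple bool :=
  [tuple of mkseq (fun k =>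
     (d <= k)%N && ~~ ((k < tau)%N && (nth ord0 w k == i))) T].

Lemma nth_plan d tau i k : (k < T)%N ->
  nth false (plan d tau i) k =
  (d <= k)%N && ~~ ((k < tau)%N && (nth ord0 w k == i)).
Proof. by move=> kT; rewrite /= nth_mkseq. Qed.

Lemma feasible_prefix (x : T.-tuple bool) :
  (forall j t, (t <= T)%N ->
    \sum_(k < t) (cons (nth ord0 w k) j * nth false x k)%:R <= t%:R :> R) <->
  feasible w x.
Proof.
split=> [H|/forallP H j [|t] tT].
- apply/forallP => t; apply/forallP => j.
  by rewrite -(ler_nat R) natr_sum; apply: H.
- by rewrite big_ord0.
by have /forallP/(_ j) := H (Ordinal tT); rewrite -(ler_nat R) natr_sum.
Qed.

(** From [d] on, the stock is [d] plus the increment of [walk] plus the units saved by refusing type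
    [i]. These savings are dropped up to [tau] and counted in full afterwards. *)
Lemma plan_feasible d tau i : (d <= tau)%N -> (tau <= T)%N ->
  (forall j t, (d <= t)%N -> (t <= tau)%N -> walk j d - walk j t <= d%:R) ->
  (forall j t, (tau <= t)%N -> (t <= T)%N ->
    walk j d - walk j t <=
    d%:R + (cons i j)%:R * (arrivals i tau - arrivals i d)) ->
  feasible w (plan d tau i).
Proof.
move=> dtau tauT H1 H2; apply/feasible_prefix => j t tT.
pose g k : R := (cons (nth ord0 w k) j * nth false (plan d tau i) k)%:R.
have gd n : (n <= d)%N -> \sum_(k < n) g k = 0.
  move=> nd; apply: big1 => k _; rewrite /g nth_plan.
    by rewrite leqNgt (leq_trans (ltn_ord k) nd) muln0.
  by rewrite (leq_trans (ltn_ord k)) // (leq_trans nd) // (leq_trans dtau).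
change (\sum_(k < t) g k <= t%:R).
have [td|dt] := leqP t d; first by rewrite gd ?ler0n.
have -> : \sum_(k < t) g k = \sum_(d <= k < t) g k.
  by rewrite sum_range ?(ltnW dt)// (gd d (leqnn d)) subr0.
have used n : (d <= n)%N ->
    \sum_(d <= k < n) (cons (nth ord0 w k) j)%:R =
    n%:R - d%:R - (walk j n - walk j d).
  move=> dn; rewrite -[_ - walk j d](sum_range (fun k => xi j (nth ord0 w k)))//.
  rewrite /xi sumrB sumr_const_nat -natrB//; ring.
have [ttau|taut] := leqP t tau.
  have : \sum_(d <= k < t) g k <= \sum_(d <= k < t) (cons (nth ord0 w k) j)%:R.
    by apply: ler_sum => k _; rewrite ler_nat -[leqRHS]muln1 leq_mul2l leq_b1 orbT.
  rewrite used ?(ltnW dt)//; have := H1 j t (ltnW dt) ttau; lra.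
have : \sum_(d <= k < t) g k <= \sum_(d <= k < t) (cons (nth ord0 w k) j)%:R
     - (cons i j)%:R * \sum_(d <= k < tau) (nth ord0 w k == i)%:R.
  rewrite !(@big_cat_nat _ _ _ tau d t) ?(ltnW taut)//= addrAC mulr_sumr -sumrB.
  apply: lerD; last first.
    by apply: ler_sum => k _; rewrite ler_nat -[leqRHS]muln1 leq_mul2l leq_b1 orbT.
  apply: ler_sum_nat => k /andP[dk ktau].
  rewrite /g nth_plan ?dk ?ktau; last exact: leq_trans ktau tauT.
  by case: eqP => [->|_]; rewrite ?muln0 ?muln1 ?mulr1 ?mulr0 ?subrr ?subr0.
rewrite used ?(ltnW dt)// (sum_range (fun k => (nth ord0 w k == i)%:R) dtau).
have := H2 j t (ltnW taut) tT; rewrite /arrivals; lra.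
Qed.

(** Each of the first [d] periods costs at most 5, the largest reward. *)
Lemma reward_plan d tau i : (d <= tau)%N -> (tau <= T)%N ->
  total - 5 * d%:R - (rew i)%:R * (arrivals i tau - arrivals i d) <=
  reward w (plan d tau i).
Proof.
move=> dtau tauT.
rewrite /total /reward.
rewrite -(big_mkord xpredT (fun k => (rew (nth ord0 w k))%:R)).
rewrite -(big_mkord xpredT
  (fun k => (rew (nth ord0 w k) * nth false (plan d tau i) k)%:R)).
rewrite /arrivals -(sum_range (fun k => (nth ord0 w k == i)%:R) dtau) mulr_sumr.
rewrite !(@big_cat_nat _ _ _ tau 0 T)//= !(@big_cat_nat _ _ _ d 0 tau)//=.
have A1 : \sum_(0 <= k < d) (rew (nth ord0 w k))%:R <= 5 * d%:R :> R.
  apply: (@le_trans _ _ (\sum_(0 <= k < d) 5)).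
    apply: ler_sum => k _; rewrite ler_nat.
    by case: (nth _ _ _) => [[|[|[|[|[|[|]]]]]] ?].
  by rewrite sumr_const_nat subn0 -[leLHS]mulr_natr.
have A2 : 0 <= \sum_(0 <= k < d)
    (rew (nth ord0 w k) * nth false (plan d tau i) k)%:R :> R.
  by apply: sumr_ge0 => k _; exact: ler0n.
have A3 : \sum_(d <= k < tau) (rew (nth ord0 w k))%:R -
    \sum_(d <= k < tau) (rew i)%:R * (nth ord0 w k == i)%:R =
    \sum_(d <= k < tau)
      (rew (nth ord0 w k) * nth false (plan d tau i) k)%:R :> R.
  rewrite -sumrB; apply: eq_big_nat => k /andP[dk ktau].
  rewrite nth_plan ?dk ?ktau; last exact: leq_trans ktau tauT.
  by case: eqP => [->|_]; rewrite ?muln0 ?muln1 ?mulr1 ?mulr0 ?subrr ?subr0.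
have A4 : \sum_(tau <= k < T) (rew (nth ord0 w k))%:R =
    \sum_(tau <= k < T)
      (rew (nth ord0 w k) * nth false (plan d tau i) k)%:R :> R.
  apply: eq_big_nat => k /andP[tauk kT].
  by rewrite nth_plan// (leq_trans dtau tauk) ltnNge tauk muln1.
lra.
Qed.

Lemma reward_le_hindsight (x : T.-tuple bool) :
  feasible w x -> reward w x <= hindsight w.
Proof. by move=> wx; rewrite /hindsight; apply: le_bigmax_cond. Qed.

Variable x : T.-tuple bool.

Definition rejections (P : pred ordtype) (t : nat) : R :=
  \sum_(k < t) (P (nth ord0 w k) && ~~ nth false x k)%:R.

Definition lost (j : 'I_2) (t : nat) : R :=
  \sum_(k < t) (cons (nth ord0 w k) j)%:R * (~~ nth false x k)%:R.

(** The stock under [x] is [walk j t + lost j t], and feasibility keeps it nonnegative. *)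
Lemma walk_lost j t : feasible w x -> (t <= T)%N -> - walk j t <= lost j t.
Proof.
move=> /feasible_prefix/(_ j t) + tT => /(_ tT).
rewrite /walk /lost /xi sumrB sumr_const card_ord.
have -> : \sum_(k < t) (cons (nth ord0 w k) j)%:R =
    \sum_(k < t) (cons (nth ord0 w k) j)%:R * (~~ nth false x k)%:R +
    \sum_(k < t) (cons (nth ord0 w k) j * nth false x k)%:R :> R.
  rewrite -big_split; apply: eq_bigr => k _ /=.
  by case: (nth false x k); rewrite ?muln1 ?muln0 ?mulr1 ?mulr0 ?addr0 ?add0r.
by lra.
Qed.

Definition only_resource1 : pred ordtype :=
  [pred i : ordtype | (i == 1 :> nat) || (i == 3 :> nat)].

Lemma lost_rejections t :
  lost ord0 t = 2 * (rejections (pred1 ord0) t + rejections only_resource1 t).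
Proof.
rewrite /lost /rejections -big_split mulr_sumr; apply: eq_bigr => k _ /=.
case: (nth false x k); rewrite /= ?andbF ?andbT ?mulr0 ?addr0 ?mulr1 ?mulr0 //.
by rewrite /cons; case: (nth ord0 w k) => [[|[|[|[|[|[|]]]]]] ?];
  rewrite //= /eq_op /=; lra.
Qed.

Lemma lost_le j t n : (t <= n)%N -> lost j t <= lost j n.
Proof.
move=> tn; apply: (ler_sum_ord_prefix (f := fun k =>
   (cons (nth ord0 w k) j)%:R * (~~ nth false x k)%:R)) => // k.
by rewrite mulr_ge0 ?ler0n.
Qed.

Lemma rejections_le P t n : (t <= n)%N -> rejections P t <= rejections P n.
Proof.
move=> tn; apply: (ler_sum_ord_prefix (f := fun k =>
   (P (nth ord0 w k) && ~~ nth false x k)%:R)) => // k; exact: ler0n.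
Qed.

(* An inventory unit of resources 1 and 2 is priced at 3/2 and 0 here, and at 1
   and 3/2 in the next lemma; the last term is the excess over these prices. *)
Lemma reward_le_resource1 :
  reward w x <= total - 3 / 2 * lost ord0 T - 2 * rejections (pred1 ord0) T.
Proof.
rewrite /reward /total /lost /rejections !mulr_sumr -!sumrB.
apply: ler_sum => k _ /=; case: (nth false x k) => /=; rewrite ?andbF ?andbT;
 rewrite /cons /rew /=; case: (nth ord0 w k) => [[|[|[|[|[|[|]]]]]] ?];
  rewrite //= /eq_op /=; lra.
Qed.

Lemma reward_le_both_resources :
  reward w x <= total - lost ord0 T - 3 / 2 * lost ord_max T
                - rejections only_resource1 T.
Proof.
rewrite /reward /total /lost /rejections !mulr_sumr -!sumrB.
apply: ler_sum => k _ /=; case: (nth false x k) => /=; rewrite ?andbF ?andbT;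
 rewrite /cons /rew /=; case: (nth ord0 w k) => [[|[|[|[|[|[|]]]]]] ?];
  rewrite //= /eq_op /=; lra.
Qed.
End Path.

(** * Loss against hindsight on typical paths of the two futures *)

Lemma ord2P (P : 'I_2 -> Prop) : P ord0 -> P ord_max -> forall j, P j.
Proof.
move=> P0 P1 [[|[|//]] j2].
  by have -> : Ordinal j2 = ord0 by apply: val_inj.
by have -> : Ordinal j2 = ord_max by apply: val_inj.
Qed.

Section Gap.
Variables (a s th : R) (T T1 : nat).
Hypotheses (a_ge : 2500 <= a) (s_ge : 100 * a ^+ 2 <= s) (thE : th * s = a).
Hypotheses (sT : s ^+ 2 = T%:R) (T1T : T1 = T./2).

Lemma half_horizon : 2 * T1%:R <= s ^+ 2 <= 2 * T1%:R + 1.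
Proof.
rewrite sT T1T -natrM natr1 !ler_nat mul2n -[X in (_ <= X)%N && _]odd_double_half.
rewrite leq_addl -{1}(odd_double_half T) -add1n leq_add2r.
by case: odd.
Qed.

Lemma T1_le : (T1 <= T)%N.
Proof. by rewrite T1T -{2}(odd_double_half T) -addnn addnA leq_addl. Qed.

(** Here [s] is the square root of [T] and [th = a / s] the drift per period. The last bound makes
    second-order terms of size [T1 * th ^ 2] negligible against the fluctuations, of order [s]. *)
Lemma scale_bounds :
  [/\ 1000 <= s, 0 < th, 2500 * (100 * th) <= 1 & T1%:R * th ^+ 2 * 200 <= s].
Proof.
have /andP[T1s sT1] := half_horizon.
have a1 := a_ge; have s2 := s_ge.
have aa : 2500 * a <= a ^+ 2 by rewrite expr2 ler_wpM2r//; lra.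
have s1 : 2500 * (100 * a) <= s by lra.
have s0 : 0 < s by lra.
have th0 : 0 < th by rewrite -(pmulr_lgt0 _ s0) thE; lra.
split; [lra|by []| |]; first by rewrite -(ler_pM2r s0) mul1r; have E := thE; lra.
have : 2 * T1%:R * th ^+ 2 <= s ^+ 2 * th ^+ 2 by rewrite ler_wpM2r ?sqr_ge0.
by rewrite -exprMn [s * _]mulrC thE; lra.
Qed.

Lemma drift_bounds : 2 * (th * T1%:R) <= a * s <= 2 * (th * T1%:R) + th.
Proof.
have /andP[T1s sT1] := half_horizon.
have [_ th0 _ _] := scale_bounds.
have -> : a * s = th * s ^+ 2 by rewrite -thE; ring.
have := ler_wpM2l (ltW th0) T1s; have := ler_wpM2l (ltW th0) sT1.
by move=> ? ?; apply/andP; split; lra.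
Qed.

Variables (d tau : nat).
Hypotheses (d_itv : 37 * s <= d%:R <= 38 * s).

Lemma deadline (r : R) : 0 <= r <= 4 -> (d <= tau)%N ->
  tau%:R - d%:R <= r * (th * T1%:R) -> (tau <= T1)%N.
Proof.
move=> r04 dtau H; rewrite -(ler_nat R).
have /andP[T1s sT1] := half_horizon.
have [s1 th0 th1 _] := scale_bounds.
have /andP[d1 d2] := d_itv; have a1 := a_ge; have /andP[r0 r4] := r04.
have rth : r * th <= 1 / 4 by nra.
have := ler_wpM2r (ler0n R T1) rth.
have : 1000 * s <= s ^+ 2 by rewrite expr2 ler_wpM2r//; lra.
lra.
Qed.

Variables (w : T.-tuple ordtype) (x : T.-tuple bool).
Hypothesis wx : feasible w x.
Hypothesis walk0 :
  forall t, (t <= T)%N -> `|walk w ord0 t + th * (minn t T1)%:R| <= 6 * s.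

Lemma walk0_drop t t' : (t <= t')%N -> (t' <= T)%N ->
  walk w ord0 t - walk w ord0 t' <=
  th * ((minn t' T1)%:R - (minn t T1)%:R) + 12 * s.
Proof.
move=> tt' t'T.
have := walk0 t'T; have := walk0 (leq_trans tt' t'T).
by rewrite !ler_norml; lra.
Qed.

(** At [T1] the shortage is about [a * s / 2 >= 1250 * s], and each refusal saves two units: this
    gives [625 * s] refusals, up to fluctuations. *)
Lemma early_rejections :
  600 * s <= rejections w x (pred1 ord0) T1 + rejections w x only_resource1 T1.
Proof.
have := walk_lost ord0 wx T1_le; rewrite lost_rejections.
have := walk0 T1_le; rewrite minnn ler_norml.
have a1 := a_ge; have [s1 th0 th1 _] := scale_bounds; have D := drift_bounds.
have : 2500 * s <= a * s by rewrite ler_wpM2r//; lra.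
lra.
Qed.

(** Type 2 arrives at rate about 1/8 and saves two units, so refusing it for [4 * th * T1] periods
    covers the shortage [th * T1]. The buffer [d] absorbs fluctuations of [12 * s] in the walk and
    [24 * s] in the savings. At the price 3/2 the terms in [th * T1] cancel; the rest is the excess
    of refusing type 1, minus [5 * d] and fluctuations. *)
Lemma gap_resource2_safe :
  (d <= tau)%N ->
  4 * (th * T1%:R) - 1 <= tau%:R - d%:R <= 4 * (th * T1%:R) ->
  (forall t, (t <= T)%N -> `|walk w ord_max t| <= 6 * s) ->
  (forall t, (t <= T1)%N ->
     `|arrivals w type2 t - 1 / 8 * (1 + th) * t%:R| <= 6 * s) ->
  2 * rejections w x (pred1 ord0) T1 - 240 * s <= hindsight w - reward w x.
Proof.
move=> dtau /andP[tau1 tau2] walk1 arr.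
have tauT1 : (tau <= T1)%N by apply: deadline tau2 => //; apply/andP; split; lra.
have tauT := leq_trans tauT1 T1_le.
have [s1 th0 th1 thT] := scale_bounds.
have /andP[d1 d2] := d_itv; have D := drift_bounds.
have T10 := ler0n R T1.
have A1 := arr _ (leq_trans dtau tauT1); have A2 := arr _ tauT1.
rewrite !ler_norml in A1 A2.
have thtau : 0 <= th * (tau%:R - d%:R) by rewrite mulr_ge0 ?subr_ge0 ?ler_nat// ltW.
have thtau2 : th * (tau%:R - d%:R) <= 4 * (T1%:R * th ^+ 2).
  have := ler_wpM2l (ltW th0) tau2; lra.
have W1 t t' : (t <= T)%N -> (t' <= T)%N ->
    walk w ord_max t - walk w ord_max t' <= 12 * s.
  by move=> tT t'T; have := walk1 _ tT; have := walk1 _ t'T; rewrite !ler_norml; lra.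
have P : feasible w (plan w d tau type2).
  apply: plan_feasible => //; apply: ord2P => t t1 t2.
  - have := walk0_drop t1 (leq_trans t2 tauT).
    rewrite (minn_idPl (leq_trans t2 tauT1)) (minn_idPl (leq_trans dtau tauT1)).
    have : th * (t%:R - d%:R) <= th * (tau%:R - d%:R).
      by rewrite ler_pM2l// lerD2r ler_nat.
    lra.
  - have := W1 d t (leq_trans dtau tauT) (leq_trans t2 tauT); lra.
  - have := walk0_drop (leq_trans dtau t1) t2; rewrite /cons /=.
    have : th * ((minn t T1)%:R - (minn d T1)%:R) <= th * T1%:R.
      rewrite ler_pM2l// lerBlDr -natrD ler_nat.
      by apply: leq_trans (geq_minr _ _) (leq_addr _ _).
    lra.
  - have := W1 d t (leq_trans dtau tauT) t2; rewrite /cons /= mul0r; lra.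
have := reward_le_hindsight P; have := reward_plan w type2 dtau tauT.
have -> : rew type2 = 3%N by [].
have := reward_le_resource1 w x.
have := lost_le w x ord0 T1_le; have := rejections_le w x (pred1 ord0) T1_le.
have := walk_lost ord0 wx T1_le; have := walk0 T1_le; rewrite minnn ler_norml.
lra.
Qed.

(** Type 1 arrives at rate about 1/4 and saves two units of both resources, so [2 * th * T1] periods
    suffice. Its reward 5 is exactly the price of these units, so the main terms cancel again. *)
Lemma gap_resource2_short :
  (d <= tau)%N ->
  2 * (th * T1%:R) - 1 <= tau%:R - d%:R <= 2 * (th * T1%:R) ->
  (forall t, (t <= T)%N -> `|walk w ord_max t + th * (t - T1)%:R| <= 6 * s) ->
  (forall t, (t <= T1)%N ->
     `|arrivals w ord0 t - 1 / 4 * (1 + th) * t%:R| <= 6 * s) ->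
  rejections w x only_resource1 T1 - 270 * s <= hindsight w - reward w x.
Proof.
move=> dtau /andP[tau1 tau2] walk1 arr.
have tauT1 : (tau <= T1)%N by apply: deadline tau2 => //; apply/andP; split; lra.
have tauT := leq_trans tauT1 T1_le.
have [s1 th0 th1 thT] := scale_bounds.
have /andP[d1 d2] := d_itv; have D := drift_bounds.
have T10 := ler0n R T1.
have A1 := arr _ (leq_trans dtau tauT1); have A2 := arr _ tauT1.
rewrite !ler_norml in A1 A2.
have thtau : 0 <= th * (tau%:R - d%:R) by rewrite mulr_ge0 ?subr_ge0 ?ler_nat// ltW.
have thtau2 : th * (tau%:R - d%:R) <= 2 * (T1%:R * th ^+ 2).
  have := ler_wpM2l (ltW th0) tau2; lra.
have /andP[HT1 HT2] := half_horizon.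
have TT1 : (T - T1)%:R = T%:R - T1%:R :> R by rewrite natrB ?T1_le.
(* For odd [T] the second half is one period longer than the first. *)
have thTT1 : th * T1%:R <= th * (T - T1)%:R <= th * T1%:R + th.
  have L1 : T1%:R <= (T - T1)%:R :> R by rewrite TT1 -sT; lra.
  have L2 : (T - T1)%:R <= T1%:R + 1 :> R by rewrite TT1 -sT; lra.
  have := ler_wpM2l (ltW th0) L1; have := ler_wpM2l (ltW th0) L2.
  by move=> ? ?; apply/andP; split; lra.
have P : feasible w (plan w d tau ord0).
  apply: plan_feasible => //; apply: ord2P => t t1 t2.
  - have := walk0_drop t1 (leq_trans t2 tauT).
    rewrite (minn_idPl (leq_trans t2 tauT1)) (minn_idPl (leq_trans dtau tauT1)).
    have : th * (t%:R - d%:R) <= th * (tau%:R - d%:R).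
      by rewrite ler_pM2l// lerD2r ler_nat.
    lra.
  - have := walk1 _ (leq_trans t2 tauT); have := walk1 _ (leq_trans dtau tauT).
    have /eqP -> : (t - T1 == 0)%N by rewrite subn_eq0 (leq_trans t2 tauT1).
    have /eqP -> : (d - T1 == 0)%N by rewrite subn_eq0 (leq_trans dtau tauT1).
    rewrite !ler_norml; lra.
  - have := walk0_drop (leq_trans dtau t1) t2; rewrite /cons /=.
    have : th * ((minn t T1)%:R - (minn d T1)%:R) <= th * T1%:R.
      rewrite ler_pM2l// lerBlDr -natrD ler_nat.
      by apply: leq_trans (geq_minr _ _) (leq_addr _ _).
    lra.
  - have := walk1 _ t2; have := walk1 _ (leq_trans dtau tauT).
    have /eqP -> : (d - T1 == 0)%N by rewrite subn_eq0 (leq_trans dtau tauT1).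
    have : th * (t - T1)%:R <= th * (T - T1)%:R by rewrite ler_pM2l// ler_nat leq_sub2r.
    rewrite /cons /= !ler_norml; lra.
have := reward_le_hindsight P; have := reward_plan w ord0 dtau tauT.
have -> : rew ord0 = 5%N by [].
have := reward_le_both_resources w x.
have := lost_le w x ord0 T1_le; have := rejections_le w x only_resource1 T1_le.
have := walk_lost ord0 wx T1_le; have := walk0 T1_le; rewrite minnn ler_norml.
have := walk_lost ord_max wx (leqnn T); have := walk1 _ (leqnn T); rewrite ler_norml.
lra.
Qed.
End Gap.

(** * Tilted laws *)

Lemma sum_ordtype (F : ordtype -> R) :
  \sum_i F i = F (@Ordinal 6 0 isT) + F (@Ordinal 6 1 isT) + F (@Ordinal 6 2 isT)
    + F (@Ordinal 6 3 isT) + F (@Ordinal 6 4 isT) + F (@Ordinal 6 5 isT).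
Proof.
by rewrite !big_ord_recr big_ord0 /= add0r;
  congr (F _ + F _ + F _ + F _ + F _ + F _); apply: val_inj.
Qed.

(** Since [xi] has mean 0 and variance 1 under [mu], the factor [1 - th * xi j i] gives stock [j]
    the drift [- th] and leaves the other one driftless. The flag [v] decides whether resource 2
    becomes short in the second half. *)
Definition tilt (th : R) (T1 : nat) (v : bool) (k : nat) (i : ordtype) : R :=
  mu i * (1 - (if (k < T1)%N then th * xi ord0 i
               else if v then th * xi ord_max i else 0)).

Section Tilt.
Variables (th : R) (T1 : nat) (v : bool).
Local Notation q := (tilt th T1 v).

Lemma tilt_sum1 k : \sum_i q k i = 1.
Proof.
rewrite sum_ordtype /tilt /mu /xi /cons /=.
by case: (k < T1)%N; case: v; lra.
Qed.

Lemma tilt_ge0 : 0 <= th <= 1 -> forall k i, 0 <= q k i.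
Proof.
move=> /andP[th0 th1] k i; apply: mulr_ge0; first exact/ltW/mu_gt0.
case: i => [[|[|[|[|[|[|]]]]]] ?]; rewrite /xi /cons //=;
  case: (k < T1)%N; case: v; lra.
Qed.

Lemma tilt_chi2 k : \sum_i q k i ^+ 2 / mu i <= 1 + th ^+ 2.
Proof.
have := sqr_ge0 th; rewrite sum_ordtype /tilt /mu /xi /cons /=.
by case: (k < T1)%N; case: v; lra.
Qed.

Lemma tilt_xi0 t : \sum_(k < t) \sum_i q k i * xi ord0 i = - th * (minn t T1)%:R.
Proof.
rewrite (eq_bigr (fun k : 'I_t => if (k < T1)%N then - th else 0)) => [|k _].
  by rewrite sum_if_lt mulr0 addr0 mulrC.
rewrite sum_ordtype /tilt /mu /xi /cons /=.
by case: (k < T1)%N; case: v; lra.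
Qed.

Lemma tilt_xi1 t : \sum_(k < t) \sum_i q k i * xi ord_max i =
  if v then - th * (t - T1)%:R else 0.
Proof.
rewrite (eq_bigr (fun k : 'I_t => if (k < T1)%N then 0 else if v then - th else 0)).
  by rewrite sum_if_lt mulr0 add0r; case: v; rewrite ?mulr0// mulrC.
move=> k _; rewrite sum_ordtype /tilt /mu /xi /cons /=.
by case: (k < T1)%N; case: v; lra.
Qed.

Lemma tilt_arrivals (i : ordtype) t : xi ord0 i = -1 -> (t <= T1)%N ->
  \sum_(k < t) \sum_j q k j * (j == i)%:R = mu i * (1 + th) * t%:R.
Proof.
move=> xii tT1.
rewrite (eq_bigr (fun=> mu i * (1 + th))) => [|k _].
  by rewrite sumr_const card_ord mulr_natr.
rewrite (bigD1 i)//= eqxx mulr1 big1 => [|j /negbTE ->]; last by rewrite mulr0.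
by rewrite addr0 /tilt (leq_trans (ltn_ord k) tT1) xii mulrN1 opprK.
Qed.
End Tilt.

(** * The two-point argument *)

Lemma nat_approx (r : R) : 0 <= r -> exists n : nat, r - 1 <= n%:R <= r.
Proof.
move=> r0; exists (Num.truncn r); have /andP[t1 t2] := truncn_itv r0.
by rewrite t1 andbT lerBlDr natr1 ltW.
Qed.

Section LowerBound.
Variables (a s th : R) (T T1 : nat) (pi : policy).
Hypotheses (a_ge : 2500 <= a) (s_ge : 100 * a ^+ 2 <= s) (thE : th * s = a).
Hypotheses (sT : s ^+ 2 = T%:R) (T1T : T1 = T./2).
Hypothesis pi_valid : valid_policy T pi.

Let bounds := scale_bounds a_ge s_ge thE sT T1T.

Let s_gt0 : 0 < s.
Proof. by have [? _ _ _] := bounds; lra. Qed.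

Let th01 : 0 <= th <= 1.
Proof. by have [_ ? ? _] := bounds; apply/andP; split; lra. Qed.

Local Notation target v := (if v then ord0 else type2).

Definition typical (v : bool) (w : seq ordtype) : bool :=
  [&& ~~ exits (tilt th T1 v) ord0 (xi ord0) (6 * s) w,
      ~~ exits (tilt th T1 v) ord0 (xi ord_max) (6 * s) w &
      ~~ exits (tilt th T1 v) ord0 (fun i => (i == target v)%:R) (6 * s) w].

(** The threshold is half of the [600 * s] early rejections; the default [true] counts missing
    periods as accepted. *)
Definition many_rejections (h : seq (ordtype * bool)) : bool :=
  300 * s <= \sum_(k < T1)
    (((nth (ord0, true) h k).1 == ord0) && ~~ (nth (ord0, true) h k).2)%:R.

(** By the maximal inequality each of the three exits has probability at most
    [T / (6 * s) ^ 2 = 1 / 36]. *)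
Lemma expect_typical v (b : seq (ordtype * bool) -> bool) :
  expect pi (tilt th T1 v) T (fun h => (b h)%:R) [::] <=
  expect pi (tilt th T1 v) T (fun h => (b h && typical v (unzip1 h))%:R) [::]
  + 1 / 12.
Proof.
have [pi01 _] := pi_valid; have q0 := tilt_ge0 T1 v th01.
have q1 := tilt_sum1 th T1 v.
have Ex g : (forall i, `|g i| <= 1) ->
    expect pi (tilt th T1 v) T 
      (fun h => (exits (tilt th T1 v) ord0 g (6 * s) (unzip1 h))%:R) [::] <= 1 / 36.
  move=> g1; apply: le_trans (expect_exits pi01 q0 q1 ord0 T _ g1) _.
    by have := s_gt0; lra.
  rewrite -sT exprMn invfM mulrA mulrAC mulfV ?mul1r ?expf_neq0 ?gt_eqF//.
  by lra.
have xi1 j i : `|xi j i| <= 1.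
  by case: j => [[|[|//]] ?]; case: i => [[|[|[|[|[|[|]]]]]] ?];
    rewrite /xi /cons //= ler_norml; lra.
have ind1 (i j : ordtype) : `|(j == i)%:R : R| <= 1.
  by case: eqP; rewrite ?normr1 ?normr0.
have := Ex _ (xi1 ord0); have := Ex _ (xi1 ord_max).
have := Ex _ (ind1 (target v)).
set E1 := expect _ _ _ _ _; set E2 := expect _ _ _ _ _; set E3 := expect _ _ _ _ _.
move=> e1 e2 e3.
suff : expect pi (tilt th T1 v) T (fun h => (b h)%:R) [::] <=
  expect pi (tilt th T1 v) T (fun h => (b h && typical v (unzip1 h))%:R) [::] +
  (E3 + (E2 + E1)) by lra.
rewrite /E1 /E2 /E3 -!expectD; apply: expect_le => // h.
by rewrite /typical; case: b => /=; do 3 case: exits => /=; lra.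
Qed.

Lemma path_gap (w : T.-tuple ordtype) (x : T.-tuple bool) : feasible w x ->
  30 * s * ((many_rejections (zip w x) && typical false (unzip1 (zip w x)))%:R +
    (~~ many_rejections (zip w x) && typical true (unzip1 (zip w x)))%:R)
  <= hindsight w - reward w x.
Proof.
move=> wx; have sz : size w = size x by rewrite !size_tuple.
have -> : many_rejections (zip w x) = (300 * s <= rejections w x (pred1 ord0) T1).
  rewrite /many_rejections /rejections; congr (_ <= _).
  apply: eq_bigr => k _; rewrite nth_zip//=.
  have kT : (k < T)%N := leq_trans (ltn_ord k) (T1_le T1T).
  by rewrite (set_nth_default false) ?size_tuple.
rewrite unzip1_zip ?sz//.
have s0 := s_gt0; have [s1 th0 _ _] := bounds.
have thT1 : 0 <= th * T1%:R by rewrite mulr_ge0 ?ler0n ?ltW.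
have [d d_itv] : exists d : nat, 37 * s <= d%:R <= 38 * s.
  have [|d /andP[d1 d2]] := @nat_approx (38 * s); first by lra.
  by exists d; apply/andP; split; lra.
have d'_itv r : 0 <= r -> exists tau : nat, (d <= tau)%N /\
   r * (th * T1%:R) - 1 <= tau%:R - d%:R <= r * (th * T1%:R).
  move=> r0; have [|n n_itv] := @nat_approx (r * (th * T1%:R)).
    exact: mulr_ge0.
  by exists (d + n)%N; rewrite leq_addr natrD [d%:R + _]addrC addrK.
have W0 v : typical v w ->
    forall t, (t <= T)%N -> `|walk w ord0 t + th * (minn t T1)%:R| <= 6 * s.
  move=> /and3P[/exitsPn H _ _] t tT; have := H t; rewrite size_tuple => /(_ tT).
  by rewrite /centered sumrB tilt_xi0 mulNr opprK.
have arr v : typical v w -> forall t, (t <= T1)%N ->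
   `|arrivals w (target v) t - mu (target v) * (1 + th) * t%:R| <= 6 * s.
  move=> /and3P[_ _ /exitsPn H] t tT1.
  have := H t; rewrite size_tuple => /(_ (leq_trans tT1 (T1_le T1T))).
  rewrite /centered sumrB tilt_arrivals//.
  by case: (v); rewrite /xi /cons /=; lra.
(* With fewer than [300 * s] refusals of type 1, at least [300 * s] fall on types 2 and 4, and the
   gap is at least [(300 - 270) * s]. In the other case it is at least [(2 * 300 - 240) * s]. *)
have [B|NB] := leP (300 * s) (rejections w x (pred1 ord0) T1) => /=; last first.
  rewrite add0r; case Ty : (typical true w); last first.
    by rewrite mulr0 subr_ge0 reward_le_hindsight.
  have [|tau [dtau tau_itv]] := d'_itv 2; first exact: ler0n.
  have W1 t : (t <= T)%N -> `|walk w ord_max t + th * (t - T1)%:R| <= 6 * s.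
    move=> tT; have /and3P[_ /exitsPn H _] := Ty.
    have := H t; rewrite size_tuple => /(_ tT).
    by rewrite /centered sumrB tilt_xi1 mulNr opprK.
  have := gap_resource2_short a_ge s_ge thE sT T1T d_itv wx (W0 _ Ty)
    dtau tau_itv W1 (arr _ Ty).
  have := early_rejections a_ge s_ge thE sT T1T wx (W0 _ Ty).
  by rewrite mulr1; lra.
rewrite addr0; case Ty : (typical false w); last first.
  by rewrite mulr0 subr_ge0 reward_le_hindsight.
have [|tau [dtau tau_itv]] := d'_itv 4; first exact: ler0n.
have W1 t : (t <= T)%N -> `|walk w ord_max t| <= 6 * s.
  move=> tT; have /and3P[_ /exitsPn H _] := Ty.
  have := H t; rewrite size_tuple => /(_ tT).
  by rewrite /centered sumrB tilt_xi1 subr0.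
have := gap_resource2_safe a_ge s_ge thE sT T1T d_itv wx (W0 _ Ty)
  dtau tau_itv W1 (arr _ Ty).
by rewrite mulr1; lra.
Qed.

(** The chi-square factor [(1 + th ^ 2) ^ T] is at most [expR (T * th ^ 2) = expR (a ^ 2)]; taking
    [K] four times as large leaves the error 1/4. *)
Lemma expect_tilt_le v f : (forall h, 0 <= f h <= 1) ->
  expect pi (tilt th T1 v) T f [::] <=
  4 * expR (a ^+ 2) * expect pi (fun=> mu) T f [::] + 1 / 4.
Proof.
move=> f01; have [pi01 _] := pi_valid.
have G0 := expR_gt0 (a ^+ 2).
have K0 : 0 < 4 * expR (a ^+ 2) by lra.
apply: le_trans (@expect_change_measure _ pi (fun=> mu) _ (1 + th ^+ 2) _ T f [::]
  pi01 (fun=> mu_gt0) (tilt_ge0 T1 v th01) (tilt_chi2 th T1 v) f01 K0) _.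
rewrite lerD2l ler_pdivrMr// mulrA mul1r mulVf ?mul1r ?pnatr_eq0//.
have -> : a ^+ 2 = T%:R * th ^+ 2 by rewrite -thE exprMn mulrC sT.
rewrite expRM_natl; apply: lerXn2r; rewrite ?nnegrE ?expR_ge0 ?expR_ge1Dx//.
by rewrite addr_ge0 ?sqr_ge0.
Qed.

Lemma regret_lower_bound : s / expR (a ^+ 2) <= regret T pi.
Proof.
have [pi01 _] := pi_valid; have q0 := tilt_ge0 T1 true th01.
have G0 := expR_gt0 (a ^+ 2); have s0 := s_gt0.
pose f1 h : R := (many_rejections h && typical false (unzip1 h))%:R.
pose f2 h : R := (~~ many_rejections h && typical true (unzip1 h))%:R.
have := @regret_ge T pi (fun h => f1 h + f2 h) (30 * s) pi_valid path_gap.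
rewrite expectD.
have f101 h : 0 <= f1 h <= 1 by rewrite ler0n lern1 leq_b1.
have f201 h : 0 <= f2 h <= 1 by rewrite ler0n lern1 leq_b1.
have := expect_tilt_le false f101; have := expect_tilt_le true f201.
have := expect_typical false many_rejections.
have := expect_typical true (fun h => ~~ many_rejections h).
rewrite -/f1 -/f2.
have E1 := expect_cst pi (tilt_sum1 th T1 true) T 1 [::].
have E2 : expect pi (tilt th T1 true) T (fun h => (many_rejections h)%:R) [::] +
  expect pi (tilt th T1 true) T (fun h => (~~ many_rejections h)%:R) [::] = 1.
  rewrite -expectD -[RHS]E1; apply: le_anti; apply/andP; split;
    by apply: expect_le => // h; case: many_rejections; rewrite /= ?addr0 ?add0r.
(* The event depends on the first [T1] periods only, where the two tilted laws agree, so the policy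
   cannot adapt it to the future. *)
have E3 : expect pi (tilt th T1 false) T (fun h => (many_rejections h)%:R) [::] =
  expect pi (tilt th T1 true) T (fun h => (many_rejections h)%:R) [::].
  apply: (@expect_local _ pi _ _ T1); try exact: tilt_sum1.
    by move=> k kT1 i; rewrite /tilt kT1.
  move=> h; congr (nat_of_bool (_ <= _))%:R.
  by apply: eq_bigr => k _; rewrite nth_take.
move: E2; rewrite -E3.
set P1 := expect pi (fun=> mu) T f1 _; set P2 := expect pi (fun=> mu) T f2 _.
move=> ? ? ? ? ? H.
(* The two errors 1/4 + 1/12 add up to 2/3, which leaves [1 / 3 <= 4 * expR (a ^ 2) * (P1 + P2)]. *)
have : 1 <= 12 * (expR (a ^+ 2) * (P1 + P2)) by lra.
move=> H2; apply: le_trans H; rewrite ler_pdivrMr//.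
have := ler_wpM2l (ltW s0) H2; nra.
Qed.
End LowerBound.

Theorem theorem3 :
  exists (T0 c : R), 0 < T0 /\ 0 < c /\
    forall (T : nat), T0 < T%:R ->
      forall pi : policy, valid_policy T pi ->
        c * Num.sqrt (T%:R) <= regret T pi.
Proof.
pose a : R := 2500.
have a0 : 0 < 100 * a ^+ 2 by rewrite mulr_gt0 ?exprn_gt0 ?ltr0n.
(* Beyond this horizon the square root of [T] is at least [100 * a ^ 2], as the scale bounds
   demand. *)
exists ((100 * a ^+ 2) ^+ 2), (expR (a ^+ 2))^-1; split; first exact: exprn_gt0.
split; first by rewrite invr_gt0 expR_gt0.
move=> T T0T pi pi_valid; rewrite mulrC.
have s_ge : 100 * a ^+ 2 <= Num.sqrt T%:R.
  rewrite -[leLHS](ger0_norm (ltW a0)) -sqrtr_sqr.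
  by apply: ler_wsqrtr; apply: ltW.
have s0 := lt_le_trans a0 s_ge.
apply: (@regret_lower_bound a _ (a / Num.sqrt T%:R) T T./2) => //.
- by rewrite mulfVK ?gt_eqF.
- by rewrite sqr_sqrtr.
Qed.
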